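(* The following equalities of classes hold: $$\begin{aligned}\mathbb{K}_{\mathbf{mbCci}}&=\{\mathcal{B}\in\mathbb{K}_{\mathbf{mbCciw}}:\mathcal{M}(\mathcal{B})\text{ validates }(\mathbf{ci})\}\\&=\{\mathcal{B}\in\mathbb{K}_{\mathbf{mbC}}:\mathcal{M}(\mathcal{B})\text{ validates }(\mathbf{ci})\}\\&=\{\mathcal{B}\in\mathbb{K}_{\mathbf{CPL}^+_{\mathbf e}}:\mathcal{M}(\mathcal{B})\text{ validates }(\mathbf{Ax10}),(\mathbf{bc1})\text{ and }(\mathbf{ci})\}\end{aligned}$$ and $$\begin{aligned}\mathbb{K}_{\mathbf{Ci}}&=\{\mathcal{B}\in\mathbb{K}_{\mathbf{mbCci}}:\mathcal{M}(\mathcal{B})\text{ validates }(\mathbf{cf})\}\\&=\{\mathcal{B}\in\mathbb{K}_{\mathbf{mbCciw}}:\mathcal{M}(\mathcal{B})\text{ validates }(\mathbf{ci})\text{ and }(\mathbf{cf})\}\\&=\{\mathcal{B}\in\mathbb{K}_{\mathbf{mbC}}:\mathcal{M}(\mathcal{B})\text{ validates }(\mathbf{ci})\text{ and }(\mathbf{cf})\}\\&=\{\mathcal{B}\in\mathbb{K}_{\mathbf{CPL}^+_{\mathbf e}}:\mathcal{M}(\mathcal{B})\text{ validates }(\mathbf{Ax10}),(\mathbf{bc1}),(\mathbf{ci})\text{ and }(\mathbf{cf})\}.\end{aligned}$$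
   Context: Let $\Sigma=\{\wedge,\vee,\to,\neg,\circ\}$ ($\neg,\circ$ unary, the others binary); $For(\Sigma)$ is the set of formulas over $\Sigma$ generated by a denumerable set of propositional variables. A multialgebra over $\Sigma$ is a nonempty set with operations whose values are nonempty subsets. For a Boolean algebra $\mathcal{A}$ with domain $A$ (the one-element Boolean algebra is allowed) and $z\in A^3$ write $z=(z_1,z_2,z_3)$; $\sim$ is Boolean complement. A swap structure for $\mathbf{CPL}^+_{\mathbf e}$ over $\mathcal{A}$ is a multialgebra $\mathcal{B}$ over $\Sigma$ with domain $|\mathcal{B}|=B\subseteq A^3$ such that $0\in\{z_1:z\in B\}$ and for all $z,w\in B$: $\emptyset\ne z\#w\subseteq\{u\in B: u_1=z_1\# w_1\}$ for $\#\in\{\wedge,\vee,\to\}$; $\emptyset\neq\neg z\subseteq\{u\in B:u_1=z_2\}$; $\emptyset\ne\circ z\subseteq\{u\in B:u_1=z_3\}$. $\mathbb{K}_{\mathbf{CPL}^+_{\mathbf e}}$ is the class of all of these, over arbitrary Boolean algebras. $\mathbb{K}_{\mathbf{mbC}}$ consists of those with $B\subseteq\{z\in A^3: z_1\vee z_2=1,\ z_1\wedge z_2\wedge z_3=0\}$; $\mathbb{K}_{\mathbf{mbCciw}}$ of those with $B\subseteq\{z\in A^3: z_1\vee z_2=1,\ z_3={\sim}(z_1\wedge z_2)\}$; $\mathbb{K}_{\mathbf{mbCci}}$ of those $\mathcal{B}\in\mathbb{K}_{\mathbf{mbCciw}}$ with $\circ z=\{({\sim}(z_1\wedge z_2),z_1\wedge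 z_2,1)\}$ for all $z\in B$; $\mathbb{K}_{\mathbf{Ci}}$ of those $\mathcal{B}\in\mathbb{K}_{\mathbf{mbCci}}$ with $\neg z\subseteq\{u\in B:u_1=z_2\text{ and }u_2\le z_1\}$ for all $z\in B$. $\mathcal{M}(\mathcal{B})=(\mathcal{B},D_{\mathcal{B}})$ is the Nmatrix with designated set $D_{\mathcal{B}}=\{z\in B: z_1=1\}$. A valuation over $\mathcal{M}(\mathcal{B})$ is $v:For(\Sigma)\to B$ with $v(\alpha\#\beta)\in v(\alpha)\#v(\beta)$, $v(\neg\alpha)\in\neg v(\alpha)$, $v(\circ\alpha)\in\circ v(\alpha)$. $\mathcal{M}(\mathcal{B})$ validates an axiom schema if $v(\gamma)\in D_{\mathcal{B}}$ for every instance $\gamma$ and every valuation $v$. The schemas are: $(\mathbf{Ax10})$ $\alpha\vee\neg\alpha$; $(\mathbf{bc1})$ $\circ\alpha\to(\alpha\to(\neg\alpha\to\beta))$; $(\mathbf{ci})$ $\neg{\circ}\alpha\to(\alpha\wedge\neg\alpha)$; $(\mathbf{cf})$ $\neg\neg\alpha\to\alpha$. *)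

(* Defs.v *)
From mathcomp Require Import all_boot all_order.
From mathcomp Require Import boolp classical_sets.
Set Implicit Arguments.
Unset Strict Implicit.
Unset Printing Implicit Defensive.

Import Order.Theory.

Local Open Scope classical_set_scope.

Variant binop := And | Or | Imp.
Variant unop := Neg | Circ.

Inductive form :=
  | Var of nat
  | Bin of binop & form & form
  | Un of unop & form.

Declare Scope form_scope.
Delimit Scope form_scope with F.
Bind Scope form_scope with form.
Notation "a ∧ b" := (Bin And a b)
  (at level 55, right associativity) : form_scope.
Notation "a ∨ b" := (Bin Or a b)
  (at level 56, right associativity) : form_scope.
Notation "a ⇒ b" := (Bin Imp a b)
  (at level 57, right associativity) : form_scope.
Notation "¬ a" := (Un Neg a) (at level 35, right associativity) : form_scope.
Notation "∘ a" := (Un Circ a) (at level 35, right associativity) : form_scope.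

Record multialgebra (T : Type) := Multialgebra {
  carrier_neq0 : inhabited T;
  mbin : binop -> T -> T -> set T;
  mun : unop -> T -> set T;
  mbin_neq0 : forall o x y, mbin o x y !=set0;
  mun_neq0 : forall o x, mun o x !=set0
}.

Record nmatrix := Nmatrix {
  ncarrier : Type;
  nalg : multialgebra ncarrier;
  designated : set ncarrier
}.
Arguments designated : clear implicits.

Definition valuation (M : nmatrix) (v : form -> ncarrier M) : Prop :=
  (forall o a b, mbin (nalg M) o (v a) (v b) (v (Bin o a b))) /\
  (forall o a, mun (nalg M) o (v a) (v (Un o a))).

(* An axiom schema is represented by the set of its instances. *)
Definition validates (M : nmatrix) (S : set form) : Prop :=
  forall c, S c -> forall v : form -> ncarrier M, valuation v -> designated M (v c).

Definition Ax10 : set form := [set (a ∨ ¬ a)%F | a in setT].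
Definition bc1 : set form :=
  [set c | exists a b : form, c = (∘ a ⇒ (a ⇒ (¬ a ⇒ b)))%F].
Definition ci : set form := [set (¬ ∘ a ⇒ (a ∧ ¬ a))%F | a in setT].
Definition cf : set form := [set (¬ ¬ a ⇒ a)%F | a in setT].

Definition bool_op d (A : ctbDistrLatticeType d) (o : binop) (x y : A) : A :=
  match o with
  | And => (x `&` y)%O
  | Or => (x `|` y)%O
  | Imp => (~` x `|` y)%O
  end.

(* A multialgebra whose domain is a set of triples over a Boolean algebra.
   ctbDistrLatticeType does not require \bot != \top, so the one-element
   Boolean algebra is included. The Boolean algebra is part of the data, as
   the designated set of the associated Nmatrix depends on it. *)
Record tripleMultialgebra := TripleMultialgebra {
  tdisp : Order.disp_t;
  tbool : ctbDistrLatticeType tdisp;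
  tdom : set (tbool * tbool * tbool);
  talg :> multialgebra tdom
}.
Arguments tdom : clear implicits.

Definition pi1 T (z : T * T * T) : T := z.1.1.
Definition pi2 T (z : T * T * T) : T := z.1.2.
Definition pi3 T (z : T * T * T) : T := z.2.

Definition nmatrix_of (B : tripleMultialgebra) : nmatrix :=
  Nmatrix B [set z : tdom B | pi1 (val z) = (\top)%O].

(* Predicates rather than classical sets: the collection of all multialgebras
   is too large, universe-wise, to be the base type of a set. *)
Definition algebra_class := tripleMultialgebra -> Prop.

Definition eq_class (K L : algebra_class) : Prop := forall B, K B <-> L B.

Notation "K ≡ L" := (eq_class K L) (at level 70, no associativity).

Definition K_CPLe : algebra_class := fun B =>
  [/\ exists z : tdom B, pi1 (val z) = (\bot)%O,
      forall o (z w : tdom B), mbin B o z w `<=`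
        [set u | pi1 (val u) = bool_op o (pi1 (val z)) (pi1 (val w))],
      forall z : tdom B, mun B Neg z `<=` [set u | pi1 (val u) = pi2 (val z)] &
      forall z : tdom B,
        mun B Circ z `<=` [set u | pi1 (val u) = pi3 (val z)]].

Definition K_mbC : algebra_class := fun B => K_CPLe B /\
  tdom B `<=` [set z | (pi1 z `|` pi2 z = \top)%O /\
                       (pi1 z `&` pi2 z `&` pi3 z = \bot)%O].

Definition K_mbCciw : algebra_class := fun B => K_CPLe B /\
  tdom B `<=` [set z | (pi1 z `|` pi2 z = \top)%O /\
                       (pi3 z = ~` (pi1 z `&` pi2 z))%O].

(* ∘ z is compared with the singleton inside the set of all triples; in
   particular the given triple belongs to the domain. *)
Definition K_mbCci : algebra_class := fun B => K_mbCciw B /\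
  forall z : tdom B, val @` mun B Circ z =
    [set ((~` (pi1 (val z) `&` pi2 (val z)))%O,
          (pi1 (val z) `&` pi2 (val z))%O, (\top)%O)].

Definition K_Ci : algebra_class := fun B => K_mbCci B /\
  forall z : tdom B, mun B Neg z `<=`
    [set u | pi1 (val u) = pi2 (val z) /\ (pi2 (val u) <= pi1 (val z))%O].

(* Main.v *)
Require Import Defs.
From mathcomp Require Import all_boot all_order.
From mathcomp Require Import boolp classical_sets.

(** Over a swap structure for CPL+e, each schema amounts to a condition on
    snapshots: (Ax10) to [z1 \/ z2 = 1], (bc1) to [z1 /\ z2 /\ z3 = 0], (ci) to
    [u2 <= z1 /\ z2] for [u] in [∘ z], and (cf) to [u2 <= z1] for [u] in [¬ z],
    because a valuation may take any prescribed value on a variable and on its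
    negation or consistency formula. Since [u1 = z3] for [u] in [∘ z], the
    conditions for (Ax10) and (ci) give [z3 \/ (z1 /\ z2) = 1], which together
    with (bc1) makes [z3] the complement of [z1 /\ z2], and then [u] is
    determined. *)

Set Implicit Arguments.
Unset Strict Implicit.
Unset Printing Implicit Defensive.

Import Order.Theory.

Section BooleanAlgebra.
Context {d : Order.disp_t} {A : ctbDistrLatticeType d}.
Implicit Types x y z : A.

(** Turns designation of an implication into an inequality between first coordinates. *)
Lemma joinCl_eq1 x y : (~` x `|` y = \top)%O <-> (x <= y)%O.
Proof.
split=> [h|h].
  by apply/meet_idPl; rewrite -[RHS](meetx1 x) -h meetUr meetxC join0x.
by apply/eqP; rewrite -le1x -(joinCx x) leU2.
Qed.

Lemma eq_complP x y : (x `&` y = \bot)%O -> (x `|` y = \top)%O -> y = (~` x)%O.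
Proof.
move=> xy0 xy1; apply/le_anti/andP; split.
  by rewrite -disj_leC meetC xy0.
by apply/joinCl_eq1; rewrite complK.
Qed.

End BooleanAlgebra.

Section Valuations.
Variable M : nmatrix.
Local Notation T := (ncarrier M).

(** By recursion on formulas: [g] selects the values at unary connectives, and arbitrary choices
    from the nonempty sets serve at binary ones. *)
Lemma valuation_exists (e : nat -> T) (g : unop -> T -> T) :
    (forall o x, mun (nalg M) o x (g o x)) ->
  exists v : form -> T, [/\ valuation v, forall n, v (Var n) = e n &
                            forall o a, v (Un o a) = g o (v a)].
Proof.
move=> gP.
pose h o x y := projT1 (cid (mbin_neq0 (nalg M) o x y)).
pose v := fix v (a : form) : T := match a with
  | Var n => e n | Bin o a b => h o (v a) (v b) | Un o a => g o (v a) end.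
exists v; split=> //; split=> [o a b|o a]; last exact: gP.
exact: (projT2 (cid (mbin_neq0 (nalg M) o (v a) (v b)))).
Qed.

Lemma valuation_through (o : unop) (z w u : T) : mun (nalg M) o z u ->
  exists v : form -> T, [/\ valuation v, v (Var 0) = z, v (Var 1) = w &
                            v (Un o (Var 0)) = u].
Proof.
move=> zu.
(* The choice is forced to be [u] only for [o] at [z]; any other selection will do elsewhere. *)
pose g o' x := if pselect (o' = o /\ x = z) then u
               else projT1 (cid (mun_neq0 (nalg M) o' x)).
have gP o' x : mun (nalg M) o' x (g o' x).
  rewrite /g; case: pselect => [[oE xE]|_] /=; first by rewrite oE xE.
  exact: (projT2 (cid (mun_neq0 (nalg M) o' x))).
have [v [vP v_var v_un]] := valuation_exists (fun n => if n is 0 then z else w) gP.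
exists v; split; rewrite ?v_un ?v_var //.
by rewrite /g; case: pselect => // -[].
Qed.

End Valuations.

Section SnapshotConditions.
Variable B : tripleMultialgebra.
Hypothesis BP : K_CPLe B.
Local Notation M := (nmatrix_of B).
Local Notation p1 z := (pi1 (val z)).
Local Notation p2 z := (pi2 (val z)).
Local Notation p3 z := (pi3 (val z)).

Lemma pi1_bin (v : form -> tdom B) o a b : valuation (M := M) v ->
  p1 (v (Bin o a b)) = bool_op o (p1 (v a)) (p1 (v b)).
Proof. by case: BP => _ h _ _ [vb _]; apply: h (vb _ _ _). Qed.

Lemma pi1_neg (v : form -> tdom B) a : valuation (M := M) v ->
  p1 (v (Un Neg a)) = p2 (v a).
Proof. by case: BP => _ _ h _ [_ vu]; apply: h (vu _ _). Qed.

Lemma pi1_circ (v : form -> tdom B) a : valuation (M := M) v ->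
  p1 (v (Un Circ a)) = p3 (v a).
Proof. by case: BP => _ _ _ h [_ vu]; apply: h (vu _ _). Qed.

Let pi1E := (pi1_bin, pi1_neg, pi1_circ).

Lemma validates_Ax10P :
  validates M Ax10 <-> forall z : tdom B, (p1 z `|` p2 z = \top)%O.
Proof.
split=> [h z|h _ [a _ <-] v vP]; last by rewrite /= !pi1E //= h.
have [u zu] := mun_neq0 B Neg z.
have [v [vP vz _ _]] := @valuation_through M Neg z z u zu.
have := h _ (ex_intro2 _ _ (Var 0) I erefl) v vP.
by rewrite /= !pi1E //= vz.
Qed.

Lemma validates_bc1P :
  validates M bc1 <-> forall z : tdom B, (p1 z `&` p2 z `&` p3 z = \bot)%O.
Proof.
(* Uncurrying: the nested implication with premises [t], [x], [y] is the single implication from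
   their meet to [w]. *)
have bc1E (x y t w : tbool B) :
    (~` t `|` (~` x `|` (~` y `|` w)) = ~` (x `&` y `&` t) `|` w)%O.
  by rewrite !complI -!joinA joinCA; congr (_ `|` _)%O; rewrite joinCA.
split=> [h z|h _ [a [b ->]] v vP]; last first.
  by rewrite /= !pi1E //= bc1E h; apply/joinCl_eq1; rewrite le0x.
(* Giving the conclusion of the schema a value with first coordinate [\bot] forces the meet of the
   premises below [\bot]. *)
have [[w w0] _ _ _] := BP.
have [u zu] := mun_neq0 B Neg z.
have [v [vP vz vw _]] := @valuation_through M Neg z w u zu.
have := h _ (ex_intro _ (Var 0) (ex_intro _ (Var 1) erefl)) v vP.
rewrite /= !pi1E //= vz vw w0 bc1E => /joinCl_eq1.
by rewrite lex0 => /eqP.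
Qed.

Lemma validates_ciP : validates M ci <->
  forall z u : tdom B, mun B Circ z u -> (p2 u <= p1 z `&` p2 z)%O.
Proof.
split=> [h z u zu|h _ [a _ <-] v vP]; last first.
  by rewrite /= !pi1E //=; apply/joinCl_eq1/h; case: vP.
have [v [vP vz _ vu]] := @valuation_through M Circ z z u zu.
have := h _ (ex_intro2 _ _ (Var 0) I erefl) v vP.
by rewrite /= !pi1E //= vz vu => /joinCl_eq1.
Qed.

Lemma validates_cfP : validates M cf <->
  forall z u : tdom B, mun B Neg z u -> (p2 u <= p1 z)%O.
Proof.
split=> [h z u zu|h _ [a _ <-] v vP]; last first.
  by rewrite /= !pi1E //=; apply/joinCl_eq1/h; case: vP.
have [v [vP vz _ vu]] := @valuation_through M Neg z z u zu.
have := h _ (ex_intro2 _ _ (Var 0) I erefl) v vP.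
by rewrite /= !pi1E //= vz vu => /joinCl_eq1.
Qed.

End SnapshotConditions.

Lemma K_mbC_Ax10_bc1 : K_mbC ≡ (fun B => K_CPLe B /\
  (validates (nmatrix_of B) Ax10 /\ validates (nmatrix_of B) bc1)).
Proof.
move=> B; split=> -[BP h]; split=> //.
  by split; [apply/validates_Ax10P|apply/validates_bc1P]=> // z;
     case: (h (val z) (set_valP z)).
case: h => /(validates_Ax10P BP) h1 /(validates_bc1P BP) h2 z zB.
by split; [exact: (h1 (SigSub (mem_set zB)))|exact: (h2 (SigSub (mem_set zB)))].
Qed.

Lemma K_mbCciw_mbC B : K_mbCciw B -> K_mbC B.
Proof.
case=> BP h; split=> // z /h [z1 z3]; split=> //.
by rewrite z3 meetxC.
Qed.

(** The converse first derives the condition on [z3], then computes the members of [∘ z]. *)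
Lemma K_mbCci_ci : K_mbCci ≡ (fun B => K_mbC B /\ validates (nmatrix_of B) ci).
Proof.
move=> B; split=> [[Bciw circ]|[BC]].
  split; first exact: K_mbCciw_mbC.
  apply/validates_ciP; first by case: Bciw.
  move=> z u zu.
  have : [set val x | x in mun B Circ z]%classic (val u) by exists u.
  by rewrite circ /= => ->.
case: BC => BP Bdom /(validates_ciP BP) ciP.
have circ1 (z u : tdom B) : mun B Circ z u -> pi1 (val u) = pi3 (val z).
  by case: BP => _ _ _ h; apply: h.
have Bciw : K_mbCciw B.
  split=> // z zB; have [z1 z0] := Bdom z zB; split=> //.
  apply: eq_complP => //; pose z' : tdom B := SigSub (mem_set zB).
  (* Any [u] in [∘ z] transfers its own law [u1 \/ u2 = 1] to [z], since [u1 = z3] and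
     [u2 <= z1 /\ z2]. *)
  have [u zu] := mun_neq0 B Circ z'.
  have [u1 _] := Bdom _ (set_valP u).
  rewrite joinC -[pi3 z](circ1 z' u zu).
  by apply/eqP; rewrite -le1x -u1 leU2 // (ciP z' u zu).
split=> // z.
have circE (u : tdom B) : mun B Circ z u ->
    val u = ((~` (pi1 (val z) `&` pi2 (val z)))%O,
             (pi1 (val z) `&` pi2 (val z))%O, \top%O).
  move=> zu; have [_ z3] := Bciw.2 _ (set_valP z).
  have [u12 u3] := Bciw.2 _ (set_valP u).
  have u1 := circ1 _ _ zu; rewrite z3 in u1.
  have u2 : pi2 (val u) = (pi1 (val z) `&` pi2 (val z))%O.
    (* The reverse inequality is [u1 \/ u2 = 1] again, as [u1] is the complement of [z1 /\ z2]. *)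
    apply/le_anti; rewrite (ciP _ _ zu) /=.
    by apply/joinCl_eq1; rewrite -u1.
  (* Now [u1] and [u2] are complementary, so [u3], the complement of their meet, is [\top]. *)
  rewrite u1 u2 meetCx compl0 in u3.
  by rewrite -u1 -u2 -u3 /pi1 /pi2 /pi3; case: (val u) => [[]].
(* Nonemptiness of [∘ z] puts the prescribed triple in the domain and in [∘ z]. *)
have [u zu] := mun_neq0 B Circ z.
apply/seteqP; split=> [_ [w /circE -> <-]//|_ ->].
by exists u => //; exact: circE.
Qed.

Lemma K_Ci_cf : K_Ci ≡ (fun B => K_mbCci B /\ validates (nmatrix_of B) cf).
Proof.
move=> B; split=> -[Bci h]; split=> //; have BP : K_CPLe B by case: Bci => -[].
  by apply/validates_cfP => // z u /h [].
move=> z u zu; split; first by case: BP => _ _ neg1 _; apply: neg1 zu.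
by move/(validates_cfP BP): h; apply.
Qed.

Theorem proposition8p15 :
  [/\ K_mbCci ≡ (fun B => K_mbCciw B /\ validates (nmatrix_of B) ci),
      K_mbCci ≡ (fun B => K_mbC B /\ validates (nmatrix_of B) ci) &
      K_mbCci ≡ (fun B => K_CPLe B /\
                         [/\ validates (nmatrix_of B) Ax10,
                             validates (nmatrix_of B) bc1 &
                             validates (nmatrix_of B) ci])] /\
  [/\ K_Ci ≡ (fun B => K_mbCci B /\ validates (nmatrix_of B) cf),
      K_Ci ≡ (fun B => K_mbCciw B /\
                      (validates (nmatrix_of B) ci /\
                       validates (nmatrix_of B) cf)),
      K_Ci ≡ (fun B => K_mbC B /\
                      (validates (nmatrix_of B) ci /\
                       validates (nmatrix_of B) cf)) &
      K_Ci ≡ (fun B => K_CPLe B /\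
                      [/\ validates (nmatrix_of B) Ax10,
                          validates (nmatrix_of B) bc1,
                          validates (nmatrix_of B) ci &
                          validates (nmatrix_of B) cf])].
Proof.
have and3E (P Q R : Prop) : [/\ P, Q & R] <-> P /\ Q /\ R by split=> [[]|[? []]].
have and4E (P Q R S : Prop) : [/\ P, Q, R & S] <-> P /\ Q /\ R /\ S.
  by split=> [[]|[? [? []]]].
(* With conjunctions flattened, the rest is propositional: [K_mbCciw] lies between [K_mbCci] and
   [K_mbC], so adding (ci) to it gives the same class as adding (ci) to [K_mbC]. *)
split; split=> B; rewrite ?and3E ?and4E;
  move: (K_mbC_Ax10_bc1 B) (K_mbCci_ci B) (K_Ci_cf B) (@K_mbCciw_mbC B)
    (fun h : K_mbCci B => h.1) => /=; tauto.
Qed.
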